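(* Let $R$ be an Abelian exchange ring. Then the group ring $R\mathbb{Z}_2$ of the cyclic group $\mathbb{Z}_2$ of order $2$ over $R$ and the group ring $RS_3$ of the symmetric group $S_3$ over $R$ are both clean rings.
   Context: All rings are associative with identity, not necessarily commutative. For a ring $R$ and a group $G$, $RG$ denotes the group ring of $G$ over $R$. A ring is Abelian if all its idempotents are central. A ring $R$ is an exchange ring if for every $a\in R$ there is an idempotent $e\in aR$ with $1-e\in (1-a)R$ (equivalently, the module $R_R$ has the finite exchange property). An element of a ring is clean if it is the sum of a unit and an idempotent; a ring is clean if every element of it is clean. *)

(* Defs.v *)
From HB Require Import structures.
From mathcomp Require Import all_boot all_order all_algebra all_fingroup.

Set Implicit Arguments.
Unset Strict Implicit.
Unset Printing Implicit Defensive.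

Import GRing.Theory.
Local Open Scope ring_scope.

(* The group ring of a finite group: since the group is finite, the finite    *)
(* support condition is void and a formal sum \sum_g x_g g is its coefficient *)
(* function. The type is a separate constant because {ffun gT -> R} already   *)
(* carries the pointwise ring structure; only addition is inherited from it.  *)
Definition group_ring (R : pzRingType) (gT : finGroupType) := {ffun gT -> R}.

Section GroupRing.
Variables (R : pzRingType) (gT : finGroupType).
Local Notation RG := (group_ring R gT).
Implicit Types x y z : RG.

HB.instance Definition _ := GRing.Zmodule.copy RG {ffun gT -> R}.

Definition gr_coef x (g : gT) : R := (x : {ffun gT -> R}) g.

Definition gr_monom (a : R) (g : gT) : RG :=
  [ffun h => if h == g then a else 0].

Definition gr_one : RG := gr_monom 1 1%g.

Definition gr_mul x y : RG :=
  [ffun g => \sum_(h : gT) gr_coef x h * gr_coef y (h^-1 * g)%g].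

Lemma gr_mulA : associative gr_mul.
Proof.
move=> x y z; apply/ffunP=> g; rewrite !ffunE /gr_coef.
under eq_bigr => h _ do rewrite ffunE big_distrr /=.
under [RHS]eq_bigr => k _ do rewrite ffunE big_distrl /=.
rewrite [RHS]exchange_big /=; apply: eq_bigr => h _.
rewrite (reindex_inj (mulgI h^-1%g)) /=; apply: eq_bigr => k _.
by rewrite mulrA invMg invgK -!mulgA mulKVg.
Qed.

Lemma gr_mul1r : left_id gr_one gr_mul.
Proof.
move=> x; apply/ffunP=> g; rewrite ffunE /gr_coef (bigD1 1%g) //= big1.
  by rewrite ffunE eqxx mul1r invg1 mul1g addr0.
by move=> h /negPf h1; rewrite ffunE h1 mul0r.
Qed.

Lemma gr_mulr1 : right_id gr_one gr_mul.
Proof.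
move=> x; apply/ffunP=> g; rewrite ffunE /gr_coef (bigD1 g) //= big1.
  by rewrite ffunE mulVg eqxx mulr1 addr0.
by move=> h hg; rewrite ffunE -eq_mulVg1 (negPf hg) mulr0.
Qed.

Lemma gr_mulDl : left_distributive gr_mul +%R.
Proof.
move=> x y z; apply/ffunP=> g; rewrite !ffunE -big_split /=.
by apply: eq_bigr => h _; rewrite /gr_coef !ffunE mulrDl.
Qed.

Lemma gr_mulDr : right_distributive gr_mul +%R.
Proof.
move=> x y z; apply/ffunP=> g; rewrite !ffunE -big_split /=.
by apply: eq_bigr => h _; rewrite /gr_coef !ffunE mulrDr.
Qed.

HB.instance Definition _ := GRing.Zmodule_isPzRing.Build RG
  gr_mulA gr_mul1r gr_mulr1 gr_mulDl gr_mulDr.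

Lemma gr_monomM (a b : R) (g h : gT) :
  gr_monom a g * gr_monom b h = gr_monom (a * b) (g * h)%g.
Proof.
apply/ffunP=> k; rewrite !ffunE (bigD1 g) //= big1 => [|l /negPf lg].
  rewrite /gr_coef !ffunE eqxx addr0 -(inj_eq (mulgI g)) mulKVg.
  by case: ifP; rewrite ?mulr0.
by rewrite /gr_coef !ffunE lg mul0r.
Qed.

Lemma gr_monom_sum x : x = \sum_(g : gT) gr_monom (gr_coef x g) g.
Proof.
apply/ffunP=> k; rewrite sum_ffunE (bigD1 k) //= big1 => [|l /negPf lk].
  by rewrite ffunE eqxx addr0.
by rewrite ffunE eq_sym lk.
Qed.

End GroupRing.

Definition is_idempotent (R : pzRingType) (e : R) : Prop := e * e = e.

(* pzRingType has no unit predicate, and the zero ring is not excluded. *)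
Definition is_unit (R : pzRingType) (u : R) : Prop :=
  exists v : R, u * v = 1 /\ v * u = 1.

Definition abelian_ring (R : pzRingType) : Prop :=
  forall e : R, is_idempotent e -> forall x : R, e * x = x * e.

Definition exchange_ring (R : pzRingType) : Prop :=
  forall a : R, exists e : R,
    is_idempotent e /\
    (exists r : R, e = a * r) /\ (exists s : R, 1 - e = (1 - a) * s).

Definition clean_element (R : pzRingType) (x : R) : Prop :=
  exists u e : R, is_unit u /\ is_idempotent e /\ x = u + e.

Definition clean_ring (R : pzRingType) : Prop := forall x : R, clean_element x.

(* Main.v *)
Require Import Defs.
From HB Require Import structures.
From mathcomp Require Import all_boot all_order all_algebra all_fingroup.

(** In an Abelian exchange ring R every a splits R into two factors, cut out
    by a central idempotent e, with a invertible on the first factor and 1 - a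
    invertible on the second. So R may be treated as if it were a local ring:
    to show that an element x of a ring B over R is clean, it suffices to treat
    the case where a chosen element a of R is a unit and the case where 1 - a
    is, at the price of replacing B by a quotient ([local_split]). Doing this finitely many times
    reduces the theorem to explicit computations.

    The basic computation concerns a ring B = R + R tau with tau central and
    tau^2 = n tau ([quad_clean]). Let x = a + b tau. Splitting at a, and
    exchanging x with 1 - x if needed, one may take a to be a unit, so that x
    is a times some 1 + c tau. The latter is a unit as soon as 1 + n c is.
    Splitting at 1 + n c leaves the case where n c, hence n, is a unit; then
    tau / n is a central idempotent, B is a product of two images of R, and R
    itself is clean. With tau = 1 + s and n = 2 this is the case of Z_2.

    For S_3, generated by s of order 2 and t of order 3, put
    tau = 1 + t + t^2, a central element with tau^2 = 3 tau. Splitting at 3,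
    either 3 or 2 is a unit. Cleanness of B follows from that of the corners
    pBp and qBq for complementary idempotents p and q ([peirce_clean_ring]),
    and suitable corners are again of the form R + R tau:
    - if 2 is a unit, take p = (1 + s) / 2 and q = (1 - s) / 2; both corners
      are R + R tau with tau^2 = 3 tau;
    - if 3 is a unit, the central idempotent tau / 3 separates a ring where
      t = 1, which is R + R (1 + s), from one where tau = 0. The latter looks
      like the 2 x 2 matrices over the image of R, and p = (1 - t)(1 + s) / 3 and
      q = (1 - s)(1 - t^2) / 3 have corners Rp and Rq.

    The rings at hand are described by relations and spanning sets only,
    without linear independence: such descriptions pass to quotients, which is
    what repeated splitting requires. *)

Set Implicit Arguments.
Unset Strict Implicit.
Unset Printing Implicit Defensive.

Import GRing.Theory.
Local Open Scope ring_scope.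

(** * Units, idempotents and clean elements *)

Section Units.
Variable B : pzRingType.
Implicit Types x y u v : B.

Lemma is_unitM x y : is_unit x -> is_unit y -> is_unit (x * y).
Proof.
move=> [x' [xx' x'x]] [y' [yy' y'y]]; exists (y' * x'); split.
  by rewrite mulrA -(mulrA x) yy' mulr1.
by rewrite mulrA -(mulrA y') x'x mulr1.
Qed.

Lemma is_unit_lr x y z : x * y = 1 -> z * x = 1 -> is_unit x.
Proof.
move=> xy zx; exists y; split=> //.
by rewrite -[y]mul1r -zx -(mulrA z) xy mulr1.
Qed.

Lemma is_unit1D_sq0 x : x * x = 0 -> is_unit (1 + x).
Proof.
by move=> xx0; exists (1 - x); split;
  rewrite mulrDl mulrDr ?mulrDl ?mulrDr ?mulr1 ?mul1r ?mulrN ?mulNr xx0 oppr0 addr0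
    ?subrK ?addrK.
Qed.

Lemma compl_idempotent x : is_idempotent x -> is_idempotent (1 - x).
Proof.
move=> xx; rewrite /is_idempotent mulrBl mul1r mulrBr mulr1 xx subrr.
by rewrite subr0.
Qed.

Lemma clean_1B x : clean_element (1 - x) -> clean_element x.
Proof.
move=> [u [e [[v [uv vu]] [ee xE]]]]; exists (- u), (1 - e); split; last split.
- by exists (- v); rewrite !mulrNN.
- exact: compl_idempotent.
- by rewrite addrCA -opprD -xE opprB addrC subrK.
Qed.

Lemma is_unit_clean x : is_unit x -> clean_element x.
Proof. by move=> ux; exists x, 0; rewrite /is_idempotent mulr0 addr0. Qed.

(** Multiples of 1 are central, and so are their inverses. *)
Lemma inv_natr_comm (n : nat) (m y : B) : n%:R * m = 1 -> m * y = y * m.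
Proof.
move=> nm; have mn : m * n%:R = 1 by rewrite commr_nat.
by rewrite -[LHS]mulr1 -nm mulrA -(mulrA m) commr_nat !mulrA mn mul1r.
Qed.

Lemma scaled_idempotent (n : nat) (m v : B) :
  n%:R * m = 1 -> v * v = n%:R * v -> is_idempotent (m * v).
Proof.
move=> nm v2; rewrite /is_idempotent mulrA -(mulrA m v m) -(inv_natr_comm v nm).
rewrite -!mulrA v2 (mulrA m n%:R) (inv_natr_comm n%:R nm) nm.
by rewrite mul1r.
Qed.

End Units.

Lemma clean_morph (A B : pzRingType) (f : {rmorphism A -> B}) x :
  clean_element x -> clean_element (f x).
Proof.
move=> [u [e [[v [uv vu]] [ee ->]]]]; exists (f u), (f e); split; last split.
- by exists (f v); rewrite -!rmorphM uv vu rmorph1.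
- by rewrite /is_idempotent -rmorphM ee.
- by rewrite rmorphD.
Qed.

(** * Corner rings *)

Section Corner.
Variables (B : pzRingType) (p : B).

Definition corner_pred : {pred B} := fun x => p * x * p == x.

Fact corner_zmod_closed : zmod_closed corner_pred.
Proof.
split; rewrite /in_mem /= /corner_pred; first by rewrite mulr0 mul0r.
by move=> x y /eqP xP /eqP yP; apply/eqP; rewrite mulrBr mulrBl xP yP.
Qed.
HB.instance Definition _ := GRing.isZmodClosed.Build B corner_pred
  corner_zmod_closed.

(** The proof of idempotency is an argument so that the ring structure, whose
    identity is [p], can be attached to the type. *)
Definition corner of is_idempotent p := {x : B | x \in corner_pred}.

Variable pp : is_idempotent p.
HB.instance Definition _ := SubChoice.on (corner pp).
HB.instance Definition _ := [SubChoice_isSubZmodule of corner pp by <:].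

Implicit Types x y z : corner pp.

Fact cut_subproof (a : B) : p * a * p \in corner_pred.
Proof. by apply/eqP; rewrite !mulrA pp -!mulrA pp. Qed.

Definition cut (a : B) : corner pp := exist _ (p * a * p) (cut_subproof a).

Lemma val_cornerD x y : val (x + y) = val x + val y.
Proof. exact: raddfD. Qed.

Lemma val_cornerB x y : val (x - y) = val x - val y.
Proof. exact: raddfB. Qed.

Lemma val_cut a : val (cut a) = p * a * p. Proof. by []. Qed.

Lemma cut_val x : cut (val x) = x.
Proof. by apply: val_inj; apply/eqP/(valP x). Qed.

Lemma corner_mull x : p * val x = val x.
Proof. by rewrite -(cut_val x) /= !mulrA pp. Qed.

Lemma corner_mulr x : val x * p = val x.
Proof. by rewrite -(cut_val x) /= -!mulrA pp. Qed.

Definition corner_one : corner pp := cut 1.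
Definition corner_mul x y : corner pp := cut (val x * val y).

Lemma val_corner_mul x y : val (corner_mul x y) = val x * val y.
Proof. by rewrite /= mulrA corner_mull -mulrA corner_mulr. Qed.

Lemma val_corner_one : val corner_one = p.
Proof. by rewrite /= mulr1 pp. Qed.

Fact corner_mulA : associative corner_mul.
Proof. by move=> x y z; apply: val_inj; rewrite !val_corner_mul mulrA. Qed.
Fact corner_mul1r : left_id corner_one corner_mul.
Proof.
by move=> x; apply: val_inj; rewrite val_corner_mul val_corner_one corner_mull.
Qed.
Fact corner_mulr1 : right_id corner_one corner_mul.
Proof.
by move=> x; apply: val_inj; rewrite val_corner_mul val_corner_one corner_mulr.
Qed.
Fact corner_mulDl : left_distributive corner_mul +%R.
Proof.
by move=> x y z; apply: val_inj; rewrite val_cornerD !val_corner_mul val_cornerD mulrDl.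
Qed.
Fact corner_mulDr : right_distributive corner_mul +%R.
Proof.
by move=> x y z; apply: val_inj; rewrite val_cornerD !val_corner_mul val_cornerD mulrDr.
Qed.
HB.instance Definition _ := GRing.Zmodule_isPzRing.Build (corner pp)
  corner_mulA corner_mul1r corner_mulr1 corner_mulDl corner_mulDr.

Lemma val_cornerM x y : val (x * y) = val x * val y.
Proof. exact: val_corner_mul. Qed.

Lemma val_corner1 : val (1 : corner pp) = p.
Proof. exact: val_corner_one. Qed.

Fact cut_is_zmod_morphism : GRing.zmod_morphism cut.
Proof.
by move=> a b; apply: val_inj; rewrite val_cornerB !val_cut mulrBr mulrBl.
Qed.
HB.instance Definition _ := GRing.isZmodMorphism.Build B (corner pp) cut
  cut_is_zmod_morphism.

Lemma cut1 : cut 1 = 1.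
Proof. by []. Qed.

(** Compression to a corner is not multiplicative on all of B, but it is
    when one factor commutes with the idempotent. *)
Lemma cutM a b : p * a = a * p -> cut a * cut b = cut (a * b).
Proof.
move=> pa; apply: val_inj; rewrite val_cornerM !val_cut !mulrA -(mulrA (p * a)) pp.
by rewrite -(mulrA p a) -pa !mulrA pp.
Qed.

Section Morphism.
Variables (R : pzRingType) (f : {rmorphism R -> B}).
Hypothesis pf : forall r, p * f r = f r * p.

(** The commutation proof is an argument so that the morphism structure can
    be attached to the function. *)
Definition cut_morph of (forall r, p * f r = f r * p) := fun r => cut (f r).

Lemma val_cut_morph r : val (cut_morph pf r) = f r * p.
Proof. by rewrite /= pf -mulrA pp. Qed.

Fact cut_morph_additive : GRing.zmod_morphism (cut_morph pf).
Proof. by move=> r r'; rewrite /cut_morph !raddfB. Qed.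
Fact cut_morph_multiplicative : GRing.monoid_morphism (cut_morph pf).
Proof. by split=> [|r r']; rewrite /cut_morph ?rmorph1 ?cut1 // rmorphM cutM. Qed.
HB.instance Definition _ := GRing.isZmodMorphism.Build R (corner pp)
  (cut_morph pf) cut_morph_additive.
HB.instance Definition _ := GRing.isMonoidMorphism.Build R (corner pp)
  (cut_morph pf) cut_morph_multiplicative.

End Morphism.

End Corner.

(** * Cleanness and the Peirce decomposition *)

Section Peirce.
Variables (B : pzRingType) (p q : B).
Hypotheses (pp : is_idempotent p) (qq : is_idempotent q) (pq1 : p + q = 1).

Let qE : q = 1 - p. Proof. by rewrite -pq1 addrAC subrr add0r. Qed.
Let pq0 : p * q = 0. Proof. by rewrite qE mulrBr mulr1 pp subrr. Qed.
Let qp0 : q * p = 0. Proof. by rewrite qE mulrBl mul1r pp subrr. Qed.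

Let mul_pq (x : corner pp) (y : corner qq) : val x * val y = 0.
Proof.
by rewrite -(corner_mulr x) -(corner_mull y) mulrA -(mulrA (val x)) pq0 mulr0 mul0r.
Qed.
Let mul_qp (y : corner qq) (x : corner pp) : val y * val x = 0.
Proof.
by rewrite -(corner_mulr y) -(corner_mull x) mulrA -(mulrA (val y)) qp0 mulr0 mul0r.
Qed.

(** The Han-Nicholson argument. Write x as a block matrix with diagonal blocks
    pxp and qxq. If pxp = f + u with u invertible, the Schur complement of u
    in x - f is clean, say w + g; then x - f - g has pivot u and Schur
    complement w, hence is invertible by block elimination. The statement is
    for one element since, for central p, it gives the cleanness of x from
    that of its two components alone. *)
Lemma peirce_clean x (u v f : corner pp) :
    u * v = 1 -> v * u = 1 -> is_idempotent f -> cut pp x = f + u ->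
    clean_element (cut qq (x - x * val v * x)) ->
  clean_element x.
Proof.
move=> uv vu ff xE [w [g [[w' [ww' w'w]] [gg yE]]]].
pose b := p * x * q; pose c := q * x * p.
have {xE} xE : p * x * p = val f + val u by rewrite -(val_cut pp) xE val_cornerD.
have {yE} yE : q * x * q = val w + val g + c * val v * b.
  have /(canRL (subrK _)) -> // : q * x * q - c * val v * b = val w + val g.
  rewrite -val_cornerD -yE val_cut mulrBr mulrBl; congr (_ - _).
  by rewrite /b /c -{2}(corner_mull v) -{2}(corner_mulr v) !mulrA.
have pb : p * b = b by rewrite /b !mulrA pp.
have bq : b * q = b by rewrite /b -!mulrA qq.
have qc : q * c = c by rewrite /c !mulrA qq.
have cp : c * p = c by rewrite /c -!mulrA pp.
(* The lower-diagonal-upper factorization of x - f - g. *)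
exists ((1 + c * val v) * (val u + val w) * (1 + val v * b)), (val f + val g).
split; last split.
- apply: is_unitM; first apply: is_unitM.
  + apply: is_unit1D_sq0; rewrite mulrA -(mulrA c) -{2}qc -(corner_mulr v).
    by rewrite -(mulrA _ p) (mulrA p) pq0 !(mul0r, mulr0).
  + exists (val v + val w'); rewrite !(mulrDl, mulrDr) !mul_pq !mul_qp.
    rewrite -!val_cornerM uv vu ww' w'w !val_corner1 addr0 add0r.
    by rewrite pq1.
  + apply: is_unit1D_sq0; rewrite mulrA -(mulrA _ b) -(corner_mull v) -bq.
    by rewrite -(mulrA _ q) (mulrA q) qp0 !(mul0r, mulr0).
- by rewrite /is_idempotent !(mulrDl, mulrDr) mul_pq mul_qp -!val_cornerM ff gg
    addr0 add0r.
have -> : x = p * x * p + b + c + q * x * q.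
  by rewrite /b /c -mulrDr -addrA -mulrDr pq1 !mulr1 -mulrDl pq1 mul1r.
rewrite xE yE !(mulrDl, mulrDr) !mul1r !mulr1.
have -> : c * val v * val u = c by rewrite -mulrA -val_cornerM vu val_corner1.
have -> : c * val v * val w = 0 by rewrite -mulrA mul_pq mulr0.
have -> : val u * (val v * b) = b by rewrite mulrA -val_cornerM uv val_corner1.
have -> : val w * (val v * b) = 0 by rewrite mulrA mul_qp mul0r.
rewrite !(mul0r, addr0) mulrA.
by rewrite !addrA [RHS](ACl (6*1*4*3*2*7*5)).
Qed.

Lemma peirce_clean_ring :
  clean_ring (corner pp) -> clean_ring (corner qq) -> clean_ring B.
Proof.
move=> cp cq x; have [u [f [[v [uv vu]] [ff xE]]]] := cp (cut pp x).
by apply: (peirce_clean uv vu ff); [rewrite addrC | apply: cq].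
Qed.

End Peirce.

(** * Splitting along central idempotents *)

Definition surj (A B : Type) (f : A -> B) := forall y, exists x, y = f x.

(** B is the product of its two corners at p and 1 - p, and [pi] stands for
    either projection. Only what survives in any quotient where p becomes 1,
    or 0, is exposed, so that splittings can be iterated. *)
Lemma central_split (B : pzRingType) (p x : B) :
    is_idempotent p -> (forall y, p * y = y * p) ->
    (forall (B' : pzRingType) (pi : {rmorphism B -> B'}),
      surj pi -> pi p = 1 -> clean_element (pi x)) ->
    (forall (B' : pzRingType) (pi : {rmorphism B -> B'}),
      surj pi -> pi p = 0 -> clean_element (pi x)) ->
  clean_element x.
Proof.
move=> pp pC c1 c0; have qq := compl_idempotent pp.
have qC y : (1 - p) * y = y * (1 - p) by rewrite mulrBl mulrBr pC mul1r mulr1.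
have pq1 : p + (1 - p) = 1 by rewrite addrC subrK.
have surj_cut (r : B) (rr : is_idempotent r) (rC : forall y : B, r * idfun y = idfun y * r) :
    surj (cut_morph rr rC).
  by move=> y; exists (val y); rewrite /cut_morph cut_val.
have [|u [f [[v [uv vu]] [ff xE]]]] := c1 _ _ (surj_cut p pp pC).
  by apply: val_inj; rewrite val_cut_morph val_corner1 pp.
apply: (peirce_clean pq1 uv vu ff (qq := qq)); first by rewrite addrC -xE.
have -> : cut qq (x - x * val v * x) = cut_morph (f := idfun) qq qC x.
  apply: val_inj; rewrite /= mulrBr mulrBl -[RHS]subr0; congr (_ - _).
  by rewrite -(corner_mull v) !mulrA qC -!mulrA (mulrA (1 - p)) mulrBl mul1r pp subrr
     !(mul0r, mulr0).
apply: (c0 _ _ (surj_cut _ qq qC)); apply: val_inj; rewrite val_cut_morph.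
by rewrite mulrBr mulr1 pp subrr raddf0.
Qed.

(** The inverse has to come from R: later splittings are made at elements of R
    that are built from it. *)
Definition inverts (R B : pzRingType) (f : R -> B) (a : R) :=
  exists r, f a * f r = 1 /\ f r * f a = 1.

Section LocalSplit.
Variable R : pzRingType.
Hypotheses (abR : abelian_ring R) (exR : exchange_ring R).

(** One-sided inverses in a corner are two-sided here: r'a is idempotent, hence
    central, and a central idempotent with a right inverse in the corner of
    identity e equals e. *)
Lemma idempotent_inverse (a r e : R) :
  is_idempotent e -> e = a * r -> exists r', a * r' = e /\ r' * a = e.
Proof.
move=> ee eE; pose r' := r * e; pose f := r' * a.
have ar' : a * r' = e by rewrite /r' mulrA -eE ee.
have r'e : r' * e = r' by rewrite /r' -mulrA ee.
have ff : is_idempotent f by rewrite /is_idempotent /f mulrA -(mulrA r') ar' r'e.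
exists r'; split=> //.
have fe : f * e = f by rewrite /f -mulrA -(abR ee) mulrA r'e.
have -> : e = f * e.
  by rewrite -{1}ee -{1 2}ar' mulrA -(mulrA a) -/f -(abR ff) -mulrA ar'.
by rewrite fe.
Qed.

(** The exchange idempotent e of a makes a invertible where e is 1, and 1 - a
    invertible where e is 0. *)
Lemma local_split (B : pzRingType) (phi : {rmorphism R -> B}) (a : R) (x : B) :
    (forall e, is_idempotent e -> forall y, phi e * y = y * phi e) ->
    (forall (B' : pzRingType) (pi : {rmorphism B -> B'}),
      surj pi -> inverts (pi \o phi) a -> clean_element (pi x)) ->
    (forall (B' : pzRingType) (pi : {rmorphism B -> B'}),
      surj pi -> inverts (pi \o phi) (1 - a) -> clean_element (pi x)) ->
  clean_element x.
Proof.
move=> phiC c1 c0; have [e [ee [[r eE] [s e'E]]]] := exR a.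
have [r' [ar r'a]] := idempotent_inverse ee eE.
have [s' [as' s'a]] := idempotent_inverse (compl_idempotent ee) e'E.
apply: (@central_split _ (phi e)) => [||B' pi pis pie|B' pi pis pie].
- by rewrite /is_idempotent -rmorphM ee.
- exact: phiC.
- by apply: c1 => //; exists r'; rewrite /= -!rmorphM ar r'a.
- apply: c0 => //; exists s'; rewrite /= -!rmorphM as' s'a.
  by rewrite !rmorphB pie subr0 !rmorph1.
Qed.

Lemma abelian_exchange_clean : clean_ring R.
Proof.
move=> a; apply: (@local_split R idfun a) => [e ee y|B' pi _ [r [ar ra]]|].
- exact: abR.
- by apply: is_unit_clean; exists (pi r).
- move=> B' pi _ [r [ar ra]]; apply: clean_1B; apply: is_unit_clean.
  by rewrite -(rmorph1 pi) -rmorphB; exists (pi r).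
Qed.

End LocalSplit.

(** * Rings R + R tau with tau^2 = n tau *)

Record quadratic (R B : pzRingType) (phi : R -> B) (n : nat) (tau : B) : Prop :=
  Quadratic {
    quad_comm : forall r, tau * phi r = phi r * tau;
    quad_sqr : tau * tau = n%:R * tau;
    quad_span : forall y, exists a b, y = phi a + phi b * tau }.

Lemma corner_quadratic (R B : pzRingType) (phi : {rmorphism R -> B}) (p : B)
    (pp : is_idempotent p) (pC : forall r, p * phi r = phi r * p) n tau :
    (forall r, tau * phi r = phi r * tau) -> p * tau = tau * p ->
    tau * tau = n%:R * tau ->
    (forall y, exists a b, p * y * p = (phi a + phi b * tau) * p) ->
  quadratic (cut_morph pp pC) n (cut pp tau).
Proof.
move=> tC pt t2 span; split=> [r||y]; rewrite /cut_morph.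
- by rewrite !cutM // tC.
- by rewrite cutM // t2 !mulr_natl raddfMn.
have [a [b yE]] := span (val y); exists a, b; apply: val_inj.
rewrite cutM // -raddfD val_cut -[LHS]corner_mulr -corner_mull yE.
have -> : p * (phi a + phi b * tau) = (phi a + phi b * tau) * p.
  by rewrite mulrDr mulrDl mulrA !pC -!mulrA pt.
by rewrite -mulrA pp.
Qed.

Section Quadratic.
Variable R : pzRingType.
Hypotheses (abR : abelian_ring R) (exR : exchange_ring R).

Lemma quadratic_surj (B B' : pzRingType) (phi : {rmorphism R -> B})
    (pi : {rmorphism B -> B'}) n tau :
  surj pi -> quadratic phi n tau -> quadratic (pi \o phi) n (pi tau).
Proof.
move=> pis [tC t2 span]; split=> [r||y] /=.
- by rewrite -!rmorphM tC.
- by rewrite -rmorphM t2 rmorphM rmorph_nat.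
- have [x ->] := pis y; have [a [b ->]] := span x.
  by exists a, b; rewrite rmorphD rmorphM.
Qed.

(** The inverse is 1 - c (1 + n c)^-1 tau, where z stands for (1 + n c)^-1. It
    is used with c z as a right inverse and with z c as a left inverse; the
    two agree automatically. *)
Lemma is_unit_1D_quadratic (B : pzRingType) (c z tau : B) (n : nat) :
    tau * c = c * tau -> tau * z = z * tau -> tau * tau = n%:R * tau ->
    (1 + n%:R * c) * z = 1 -> z * (1 + n%:R * c) = 1 ->
  is_unit (1 + c * tau).
Proof.
move=> tc tz t2 cz zc.
have t2M x y : tau * y = y * tau -> x * tau * (y * tau) = x * (n%:R * y) * tau.
  by move=> ty; rewrite mulrA -(mulrA x) ty -!mulrA t2 (mulrA y) commr_nat !mulrA.
have czE : c * z + c * (n%:R * (c * z)) = c.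
  by rewrite !mulrA -mulrDl -mulrA -{1}[c]mulr1 -mulrDr -mulrA cz mulr1.
have zcE : z * c + z * c * (n%:R * c) = c.
  rewrite [in X in _ + X]mulrA -(mulrA z) commr_nat !mulrA -mulrDl.
  by rewrite -{1}[z]mulr1 -mulrA -mulrDr zc mul1r.
apply: (@is_unit_lr _ _ (1 - c * z * tau) (1 - z * c * tau)).
  rewrite mulrDl mul1r mulrBr mulr1 t2M; last by rewrite mulrA tc -mulrA tz mulrA.
  by rewrite -addrA [X in 1 + X]addrCA -opprD -mulrDl czE subrr addr0.
rewrite mulrDr mulr1 mulrBl mul1r t2M //.
by rewrite -addrA [X in 1 + X]addrCA -opprD -mulrDl zcE subrr addr0.
Qed.

Section Fixed.
Variables (B : pzRingType) (phi : {rmorphism R -> B}) (n : nat) (tau : B).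
Hypothesis quad : quadratic phi n tau.

Lemma quad_idem_central e :
  is_idempotent e -> forall y, phi e * y = y * phi e.
Proof.
move=> ee y; have [a [b ->]] := quad_span quad y.
by rewrite mulrDl mulrDr mulrA -(mulrA _ tau) (quad_comm quad) !mulrA -!rmorphM !(abR ee).
Qed.

Lemma quad_central y : tau * y = y * tau.
Proof.
have [a [b ->]] := quad_span quad y.
by rewrite mulrDl mulrDr mulrA !(quad_comm quad).
Qed.

(** The central idempotent tau / n splits B into a factor where tau = n and
    one where tau = 0; both are images of R. *)
Lemma quad_inv_clean (m : B) : n%:R * m = 1 -> clean_ring B.
Proof.
move=> nm x; have mC y := inv_natr_comm y nm.
have nmt : n%:R * (m * tau) = tau by rewrite mulrA nm mul1r.
have [a [b ->]] := quad_span quad x.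
apply: (@central_split _ (m * tau)) => [|y|B' pi _ pi1|B' pi _ pi0].
- exact: scaled_idempotent nm (quad_sqr quad).
- by rewrite -mulrA quad_central mulrA mC mulrA.
- have pit : pi tau = n%:R by rewrite -nmt rmorphM pi1 rmorph_nat mulr1.
  have -> : pi (phi a + phi b * tau) = (pi \o phi) (a + b * n%:R).
    by rewrite /= !rmorphD !rmorphM pit !rmorph_nat.
  exact/clean_morph/abelian_exchange_clean.
- have pit : pi tau = 0 by rewrite -nmt rmorphM pi0 mulr0.
  rewrite rmorphD rmorphM pit mulr0 addr0.
  exact: (clean_morph (pi \o phi) (abelian_exchange_clean abR exR a)).
Qed.

End Fixed.

(** With c = a^-1 b, the element is a (1 + c tau). Either 1 + n c is a unit,
    and the element is one too, or n c is a unit, and then so is n. *)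
Lemma quad_unit_clean (B : pzRingType) (phi : {rmorphism R -> B}) n tau a b :
  quadratic phi n tau -> inverts phi a -> clean_element (phi a + phi b * tau).
Proof.
move=> quad [r [ar ra]]; pose c := r * b.
apply: (local_split abR exR (phi := phi) (a := 1 + n%:R * c)).
- exact: quad_idem_central quad.
- move=> B' pi pis [z [cz zc]]; have [tC t2 _] := quadratic_surj pis quad.
  apply: is_unit_clean.
  have -> : pi (phi a + phi b * tau) = pi (phi a) * (1 + pi (phi c) * pi tau).
    have acE : phi a * phi c = phi b by rewrite rmorphM mulrA ar mul1r.
    by rewrite mulrDr mulr1 mulrA -rmorphM acE rmorphD rmorphM.
  apply: is_unitM; first by exists (pi (phi r)); rewrite -!(rmorphM pi) ar ra rmorph1.
  apply: (@is_unit_1D_quadratic _ _ (pi (phi z)) _ n) => //; [exact: tC | exact: tC | |].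
    by rewrite -[RHS]cz /= !(rmorphD, rmorphM, rmorph1, rmorph_nat).
  by rewrite -[RHS]zc /= !(rmorphD, rmorphM, rmorph1, rmorph_nat).
- move=> B' pi pis [z [cz _]].
  apply: (quad_inv_clean (quadratic_surj pis quad) (m := - pi (phi (c * z)))).
  rewrite -[RHS]cz /= opprD addrA subrr add0r.
  by rewrite !(rmorphN, rmorphM, rmorph_nat) mulrN mulNr !mulrA.
Qed.

Lemma quad_clean (B : pzRingType) (phi : {rmorphism R -> B}) n tau :
  quadratic phi n tau -> clean_ring B.
Proof.
move=> quad x; have [a [b ->]] := quad_span quad x.
apply: (local_split abR exR (phi := phi) (a := a)).
- exact: quad_idem_central quad.
- move=> B' pi pis inv_a; rewrite rmorphD rmorphM.
  exact: (quad_unit_clean b (quadratic_surj pis quad)).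
- move=> B' pi pis inv_a; apply: clean_1B.
  have -> : 1 - pi (phi a + phi b * tau)
          = (pi \o phi) (1 - a) + (pi \o phi) (- b) * pi tau.
    by rewrite /= !(rmorphB, rmorphD, rmorphN, rmorphM, rmorph1) mulNr opprD addrA.
  exact: quad_unit_clean (quadratic_surj pis quad) inv_a.
Qed.

End Quadratic.

(** * Quotients of the group ring of S_3 *)

Record s3_generated (R B : pzRingType) (phi : R -> B) (s t : B) : Prop :=
  S3Generated {
    s3_commS : forall r, s * phi r = phi r * s;
    s3_commT : forall r, t * phi r = phi r * t;
    s3_ss : s * s = 1;
    s3_ttt : t * t * t = 1;
    s3_st : s * t = t * t * s;
    s3_span : forall y, exists a0 a1 a2 b0 b1 b2,
      y = phi a0 + phi a1 * t + phi a2 * (t * t)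
        + (phi b0 + phi b1 * t + phi b2 * (t * t)) * s }.

Section S3.
Variable R : pzRingType.
Hypotheses (abR : abelian_ring R) (exR : exchange_ring R).

Lemma s3_surj (B B' : pzRingType) (phi : {rmorphism R -> B})
    (pi : {rmorphism B -> B'}) s t :
  surj pi -> s3_generated phi s t -> s3_generated (pi \o phi) (pi s) (pi t).
Proof.
move=> pis [sC tC ss ttt st span]; split=> [r|r||||y] /=; rewrite -?rmorphM.
- by rewrite sC rmorphM.
- by rewrite tC rmorphM.
- by rewrite ss rmorph1.
- by rewrite ttt rmorph1.
- by rewrite st.
have [x ->] := pis y; have [a0 [a1 [a2 [b0 [b1 [b2 ->]]]]]] := span x.
by exists a0, a1, a2, b0, b1, b2; rewrite !(rmorphD, rmorphM).
Qed.

(** The relations are invariant under s -> -s. This symmetry carries facts about 1 + s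
    over to 1 - s. *)
Lemma s3_oppS (B : pzRingType) (phi : {rmorphism R -> B}) s t :
  s3_generated phi s t -> s3_generated phi (- s) t.
Proof.
move=> [sC tC ss ttt st span]; split=> // [r||| y].
- by rewrite mulNr sC mulrN.
- by rewrite mulrNN.
- by rewrite mulNr mulrN st.
have [a0 [a1 [a2 [b0 [b1 [b2 ->]]]]]] := span y.
exists a0, a1, a2, (- b0), (- b1), (- b2).
by rewrite !rmorphN !mulNr -!opprD mulrNN.
Qed.

(** The idempotents used below are v / n with v integral, and mu is 1 / n. It
    is required to lie in R because the coefficients spanning the corner are
    multiples of it. *)
Lemma scaled_corner_clean (B : pzRingType) (phi : {rmorphism R -> B}) (n k : nat)
    mu v tau (pp : is_idempotent (phi mu * v)) :
    n%:R * phi mu = 1 -> (forall r, v * phi r = phi r * v) ->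
    (forall r, tau * phi r = phi r * tau) -> v * tau = tau * v ->
    tau * tau = k%:R * tau ->
    (forall y, exists a b, v * y * v = (phi a + phi b * tau) * v) ->
  clean_ring (corner pp).
Proof.
move=> nmu vC tC vt t2 span; have mC y := inv_natr_comm y nmu.
have pC r : phi mu * v * phi r = phi r * (phi mu * v).
  by rewrite -mulrA vC mulrA mC mulrA.
apply: (quad_clean abR exR (corner_quadratic pp pC tC _ t2 _)) => [|y].
  by rewrite -mulrA vt mulrA mC mulrA.
have [a [b yE]] := span y; exists (mu * a), (mu * b).
have -> : phi (mu * a) + phi (mu * b) * tau = phi mu * (phi a + phi b * tau).
  by rewrite !rmorphM mulrDr !mulrA.
rewrite [LHS]mulrA -(mC (_ * y)) -!mulrA (mulrA v) yE.
by rewrite [in RHS](mulrA _ (phi mu)) -mC !mulrA.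
Qed.

Section Fixed.
Variables (B : pzRingType) (phi : {rmorphism R -> B}) (s t : B).
Hypothesis gen : s3_generated phi s t.
Local Notation tau := (1 + t + t * t).

Let sC := s3_commS gen.
Let tC := s3_commT gen.
Let ss := s3_ss gen.
Let ttt := s3_ttt gen.
Let st := s3_st gen.

Let stt : s * (t * t) = t * s.
Proof. by rewrite mulrA st -mulrA st !mulrA ttt mul1r. Qed.

Lemma s3_phi_central z :
  (forall r, z * phi r = phi r * z) -> z * s = s * z -> z * t = t * z ->
  forall y, z * y = y * z.
Proof.
move=> zp zs zt y; have [a0 [a1 [a2 [b0 [b1 [b2 ->]]]]]] := s3_span gen y.
have cM u v : z * u = u * z -> z * v = v * z -> z * (u * v) = u * v * z.
  by move=> zu zv; rewrite mulrA zu -!mulrA zv.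
have cD u v : z * u = u * z -> z * v = v * z -> z * (u + v) = (u + v) * z.
  by move=> zu zv; rewrite mulrDr mulrDl zu zv.
by do !(apply: (cD _ _) || apply: (cM _ _)).
Qed.

Lemma s3_idem_central e :
  is_idempotent e -> forall y, phi e * y = y * phi e.
Proof.
by move=> ee; apply: s3_phi_central => [r||]; rewrite ?sC ?tC // -!rmorphM abR.
Qed.

Lemma s3_mul_t_tau : t * tau = tau.
Proof. by rewrite !mulrDr mulr1 mulrA ttt [RHS](ACl (2*3*1)). Qed.

Lemma s3_mul_tau_t : tau * t = tau.
Proof. by rewrite !mulrDl mul1r ttt [RHS](ACl (2*3*1)). Qed.

Lemma s3_tau_central y : tau * y = y * tau.
Proof.
apply: s3_phi_central => [r||]; last by rewrite s3_mul_t_tau s3_mul_tau_t.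
  by rewrite !(mulrDl, mulrDr) mul1r mulr1 -(mulrA t t) tC (mulrA t) tC !mulrA.
by rewrite !(mulrDl, mulrDr) mul1r mulr1 stt st addrAC.
Qed.

Lemma s3_tau_sqr : tau * tau = 3%:R * tau.
Proof.
rewrite {1}mulrDl mulrDl mul1r -mulrA !s3_mul_t_tau.
by rewrite mulr_natl !mulrS mulr0n addr0 addrA.
Qed.

Local Notation u := (1 + s).

Let su : s * u = u. Proof. by rewrite mulrDr mulr1 ss addrC. Qed.

Lemma s3_uphi r : u * phi r = phi r * u.
Proof. by rewrite mulrDl mulrDr mul1r mulr1 sC. Qed.

Lemma s3_1BtC r : (1 - t) * phi r = phi r * (1 - t).
Proof. by rewrite mulrBl mulrBr mul1r mulr1 tC. Qed.

Lemma s3_uu : u * u = 2%:R * u.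
Proof. by rewrite {1}mulrDl mul1r su mulr_natl mulr2n. Qed.

Lemma s3_utu : u * t * u = (tau - 1) * u.
Proof.
rewrite (mulrDl 1 s t) mul1r st mulrDl -(mulrA (t * t)) su -mulrDl.
by congr (_ * _); rewrite [RHS]addrC -addrA addKr.
Qed.

Lemma s3_uttu : u * (t * t) * u = (tau - 1) * u.
Proof.
rewrite (mulrDl 1 s) mul1r stt mulrDl -(mulrA t s) su -mulrDl.
by congr (_ * _); rewrite [RHS]addrC -addrA addKr addrC.
Qed.

(** On multiples of u the generator s acts as 1, and compressing t or t^2
    by u gives tau - 1: only R and tau remain. *)
Lemma s3_uyu y : exists a b, u * y * u = (phi a + phi b * tau) * u.
Proof.
have [a0 [a1 [a2 [b0 [b1 [b2 ->]]]]]] := s3_span gen y.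
pose a := a0 + b0; pose b := a1 + b1; pose c := a2 + b2.
exists (2%:R * a - b - c), (b + c).
rewrite -mulrA (mulrDl _ _ u) -(mulrA _ s) su -mulrDl.
have -> : phi a0 + phi a1 * t + phi a2 * (t * t) +
    (phi b0 + phi b1 * t + phi b2 * (t * t))
  = phi a + phi b * t + phi c * (t * t).
  rewrite /a /b /c !rmorphD !mulrDl !addrA.
  by rewrite [LHS](ACl (1*4*2*5*3*6)).
have uCM r v : u * (phi r * v) * u = phi r * (u * v * u).
  by rewrite mulrA s3_uphi -!mulrA.
rewrite mulrA 2!(mulrDr u) 2!(mulrDl _ _ u) !uCM s3_uphi -mulrA s3_uu s3_utu s3_uttu.
rewrite !mulrA -!mulrDl; congr (_ * u).
rewrite -[LHS]addrA -mulrDl -rmorphD mulrBr mulr1 -(addrA (2%:R * a)) -opprD.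
by rewrite rmorphB rmorphM rmorph_nat commr_nat addrA addrAC.
Qed.

(** The corner R + R tau is of quadratic type with n = 3. *)
Lemma s3_half_corner mu (pp : is_idempotent (phi mu * u)) :
  2%:R * phi mu = 1 -> clean_ring (corner pp).
Proof.
move=> mu2; apply: (scaled_corner_clean mu2 s3_uphi _ _ s3_tau_sqr s3_uyu).
  by move=> r; rewrite s3_tau_central.
by rewrite s3_tau_central.
Qed.

(** Compressing by (1 - t) u reduces to compressing by u, where tau = 0 leaves
    only R. The corner is an image of R, seen as a quadratic ring with
    vanishing generator. *)
Lemma s3_third_corner mu (pp : is_idempotent (phi mu * ((1 - t) * u))) :
  tau = 0 -> 3%:R * phi mu = 1 -> clean_ring (corner pp).
Proof.
move=> tau0 mu3.
apply: (scaled_corner_clean (k := 0) (tau := 0) mu3) => [r|r||| y].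
- by rewrite -mulrA s3_uphi !mulrA s3_1BtC.
- by rewrite mulr0 mul0r.
- by rewrite mulr0 mul0r.
- by rewrite mulr0.
have [a [b yE]] := s3_uyu (y * (1 - t)); exists a, 0.
rewrite !mulr0 addr0 mulrA -!mulrA (mulrA y) (mulrA u).
by rewrite yE tau0 mulr0 addr0 !mulrA s3_1BtC.
Qed.

Lemma s3_third_corner_compl mu (pp : is_idempotent (phi mu * (u * (1 - t * t)))) :
  tau = 0 -> 3%:R * phi mu = 1 -> clean_ring (corner pp).
Proof.
move=> tau0 mu3.
have ttC r : (1 - t * t) * phi r = phi r * (1 - t * t).
  by rewrite mulrBl mulrBr mul1r mulr1 -(mulrA t t) tC (mulrA t) tC !mulrA.
apply: (scaled_corner_clean (k := 0) (tau := 0) mu3) => [r|r||| y].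
- by rewrite -mulrA ttC !mulrA s3_uphi.
- by rewrite mulr0 mul0r.
- by rewrite mulr0 mul0r.
- by rewrite mulr0.
have [a [b yE]] := s3_uyu ((1 - t * t) * y); exists a, 0.
by rewrite !mulr0 !addr0 -(mulrA u) mulrA yE tau0 mulr0 addr0 !mulrA.
Qed.

Lemma s3_third_idempotent mu :
  tau = 0 -> 3%:R * phi mu = 1 -> is_idempotent (phi mu * ((1 - t) * u)).
Proof.
move=> tau0 mu3; apply: (scaled_idempotent mu3).
have key : u * (1 - t) * u = 3%:R * u.
  by rewrite mulrBr mulrBl mulr1 s3_uu s3_utu tau0 sub0r mulN1r opprK -{2}[u]mul1r
    -mulrDl natr1.
by rewrite -mulrA (mulrA u) key !mulrA commr_nat.
Qed.

End Fixed.

Lemma s3_half_clean (B : pzRingType) (phi : {rmorphism R -> B}) s t mu :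
  s3_generated phi s t -> 2%:R * phi mu = 1 -> clean_ring B.
Proof.
move=> gen mu2; have gen' := s3_oppS gen.
have pp : is_idempotent (phi mu * (1 + s)).
  exact: (scaled_idempotent mu2 (s3_uu gen)).
have qq : is_idempotent (phi mu * (1 - s)).
  exact: (scaled_idempotent mu2 (s3_uu gen')).
apply: (peirce_clean_ring (pp := pp) (qq := qq)).
- by rewrite -mulrDr addrCA -addrA subrr addr0 addrC (inv_natr_comm _ mu2).
- exact: (s3_half_corner gen).
- exact: (s3_half_corner gen').
Qed.

(** With tau = 0 the ring is a quotient of the 2 x 2 matrices over the image of
    R. The idempotents below are the two diagonal ones for a basis chosen so
    that 3 is the only denominator. *)
Lemma s3_third0_clean (B : pzRingType) (phi : {rmorphism R -> B}) s t mu :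
    s3_generated phi s t -> 1 + t + t * t = 0 -> 3%:R * phi mu = 1 ->
  clean_ring B.
Proof.
move=> gen tau0 mu3; have gen' := s3_oppS gen.
have pp := s3_third_idempotent gen tau0 mu3.
have pq1 : phi mu * ((1 - t) * (1 + s)) + phi mu * ((1 - s) * (1 - t * t)) = 1.
  (* The terms in s cancel and the others add up to 3 - tau. *)
  have sE : s * (1 - t * t) = (1 - t) * s.
    by rewrite mulrBr mulr1 mulrA (s3_st gen) -mulrA (s3_st gen) !mulrA (s3_ttt gen)
      mulrBl !mul1r.
  rewrite -mulrDr (mulrDr (1 - t)) mulr1 (mulrBl _ 1 s) mul1r sE.
  rewrite addrACA subrr addr0.
  have -> : 1 - t + (1 - t * t) = 3%:R.
    rewrite addrACA -opprD -[1 + 1]/(2%:R) -[LHS]addr0 -tau0.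
    by rewrite -(addrA 1 t) [1 + (t + _)]addrC addrA subrK natr1.
  by rewrite (inv_natr_comm _ mu3).
have qq : is_idempotent (phi mu * ((1 - s) * (1 - t * t))).
  by rewrite -[X in is_idempotent X](addKr (phi mu * ((1 - t) * (1 + s)))) pq1
     addrC; apply: compl_idempotent.
apply: (peirce_clean_ring (pp := pp) (qq := qq) pq1).
- exact: (s3_third_corner gen).
- exact: (s3_third_corner_compl gen').
Qed.

Lemma s3_third_clean (B : pzRingType) (phi : {rmorphism R -> B}) s t mu :
  s3_generated phi s t -> 3%:R * phi mu = 1 -> clean_ring B.
Proof.
move=> gen mu3 x; pose tau := 1 + t + t * t.
have mC y := inv_natr_comm y mu3.
have taum : 3%:R * (phi mu * tau) = tau by rewrite mulrA mu3 mul1r.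
apply: (@central_split _ (phi mu * tau)) => [|y|B' pi pis pi1|B' pi pis pi0].
- exact: (scaled_idempotent mu3 (s3_tau_sqr gen)).
- by rewrite -mulrA (s3_tau_central gen) mulrA mC mulrA.
- have pit : pi t = 1.
    by rewrite -[pi t]mul1r -pi1 -rmorphM -mulrA (s3_mul_tau_t gen).
  have [sC _ ss _ _ span] := s3_surj pis gen.
  apply: (@quad_clean _ abR exR _ (pi \o phi) 2 (1 + pi s)).
  split=> [r||y]; [exact: s3_uphi (s3_surj pis gen) r | exact: s3_uu (s3_surj pis gen) |].
  have [a0 [a1 [a2 [b0 [b1 [b2 ->]]]]]] := span y.
  exists (a0 + a1 + a2 - (b0 + b1 + b2)), (b0 + b1 + b2).
  rewrite pit !mulr1 -!rmorphD mulrDr mulr1 addrA; congr (_ + _).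
  by rewrite -rmorphD subrK.
- have pit : 1 + pi t + pi t * pi t = 0.
    by rewrite -rmorphM -(rmorph1 pi) -!rmorphD -/tau -taum rmorphM pi0 mulr0.
  apply: (s3_third0_clean (s3_surj pis gen) pit (mu := mu)).
  by rewrite -(rmorph_nat pi) -rmorphM mu3 rmorph1.
Qed.

(** The local splitting at 3: either 3 or 1 - 3 = - 2 is a unit. *)
Lemma s3_clean (B : pzRingType) (phi : {rmorphism R -> B}) s t :
  s3_generated phi s t -> clean_ring B.
Proof.
move=> gen x; apply: (local_split abR exR (phi := phi) (a := 3%:R)).
- exact: s3_idem_central gen.
- move=> B' pi pis [r [r3 _]]; apply: (s3_third_clean (s3_surj pis gen) (mu := r)).
  by rewrite -[RHS]r3 /= !rmorph_nat.
- move=> B' pi pis [r [r3 _]]; apply: (s3_half_clean (s3_surj pis gen) (mu := - r)).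
  have r32 : 1 - 3%:R = - 2%:R :> R.
    by rewrite -[3%:R]natr1 opprD addrCA subrr addr0.
  by rewrite -[RHS]r3 r32 /= !(rmorphN, rmorph_nat) mulrN mulNr.
Qed.

End S3.

(** * The group rings of Z_2 and S_3 *)

Section GroupRingGenerators.
Variables (R : pzRingType) (gT : finGroupType).
Local Notation RG := (group_ring R gT).

Definition gr_const (a : R) : RG := gr_monom a 1%g.

Fact gr_const_zmod_morphism : GRing.zmod_morphism gr_const.
Proof.
by move=> a b; apply/ffunP=> g; rewrite !ffunE; case: eqP; rewrite ?subr0.
Qed.
Fact gr_const_monoid_morphism : GRing.monoid_morphism gr_const.
Proof. by split=> // a b; rewrite /gr_const gr_monomM mulg1. Qed.
HB.instance Definition _ :=
  GRing.isZmodMorphism.Build R RG gr_const gr_const_zmod_morphism.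
HB.instance Definition _ :=
  GRing.isMonoidMorphism.Build R RG gr_const gr_const_monoid_morphism.

Definition gr_elt (g : gT) : RG := gr_monom 1 g.

Lemma gr_elt1 : gr_elt 1%g = 1. Proof. by []. Qed.

Lemma gr_eltM g h : gr_elt g * gr_elt h = gr_elt (g * h)%g.
Proof. by rewrite /gr_elt gr_monomM mulr1. Qed.

Lemma gr_monomE a g : gr_monom a g = gr_const a * gr_elt g.
Proof. by rewrite gr_monomM mulr1 mul1g. Qed.

Lemma gr_elt_comm g a : gr_elt g * gr_const a = gr_const a * gr_elt g.
Proof. by rewrite !gr_monomM mulr1 mul1r mul1g mulg1. Qed.

(** Listing the group explicitly turns the formal sum into the spanning
    expressions of the previous parts. *)
Lemma gr_enum (e : seq gT) (x : RG) :
  uniq e -> size e = #|gT| ->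
  x = \sum_(g <- e) gr_const (gr_coef x g) * gr_elt g.
Proof.
move=> ue se; rewrite {1}[x]gr_monom_sum (perm_big e) /=.
  by apply: eq_bigr => g _; rewrite gr_monomE.
apply: uniq_perm => [||g]; rewrite ?index_enum_uniq //.
have [//||_ eE] := @uniq_min_size _ e (enum gT) ue; last by rewrite eE mem_enum mem_index_enum.
  by move=> h _; rewrite mem_enum.
by rewrite -cardE se.
Qed.

End GroupRingGenerators.

Lemma z2_quadratic (R : pzRingType) :
  quadratic (@gr_const R 'Z_2) 2 (1 + gr_elt R (1%R : 'Z_2)).
Proof.
split=> [r||x].
- by rewrite mulrDl mulrDr mul1r mulr1 gr_elt_comm.
- rewrite {1}mulrDl mul1r mulrDr mulr1 gr_eltM.
  have -> : ((1%R : 'Z_2) * (1%R : 'Z_2))%g = 1%g by apply: val_inj.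
  by rewrite gr_elt1 [X in _ + X]addrC mulr_natl mulr2n.
rewrite (gr_enum (e := [:: 1%g; (1%R : 'Z_2)]) x) //; last by rewrite card_ord.
rewrite big_cons big_seq1 gr_elt1 mulr1; move: (gr_coef x _) (gr_coef x _) => b a.
by exists (a - b), b; rewrite mulrDr mulr1 addrA -rmorphD subrK.
Qed.

Lemma s3_group_ring (R : pzRingType) : exists s t : group_ring R 'S_3,
  s3_generated (@gr_const R 'S_3) s t.
Proof.
pose i0 : 'I_3 := ord0; pose i1 : 'I_3 := lift i0 ord0; pose i2 : 'I_3 := ord_max.
pose s : 'S_3 := tperm i0 i1; pose t : 'S_3 := (s * tperm i1 i2)%g.
have ord3 (P : 'I_3 -> Prop) : P i0 -> P i1 -> P i2 -> forall i, P i.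
  move=> P0 P1 P2 [[|[|[|//]]] lt_i3].
  - by rewrite (_ : Ordinal _ = i0) //; apply: val_inj.
  - by rewrite (_ : Ordinal _ = i1) //; apply: val_inj.
  - by rewrite (_ : Ordinal _ = i2) //; apply: val_inj.
have [s0 s1 s2] : [/\ s i0 = i1, s i1 = i0 & s i2 = i2].
  by rewrite /s tpermL tpermR tpermD.
have [t0 t1 t2] : [/\ t i0 = i2, t i1 = i0 & t i2 = i1].
  by rewrite /t !permM s0 s1 s2 tpermL tpermR tpermD.
have ss : (s * s = 1)%g by rewrite /s tperm2.
clearbody t s.
have ttt : (t * t * t = 1)%g.
  by apply/permP; apply: ord3; rewrite !permM perm1 !(t0, t1, t2).
have st : (s * t = t * t * s)%g.
  by apply/permP; apply: ord3; rewrite !permM !(t0, t1, t2, s0, s1, s2).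
exists (gr_elt R s), (gr_elt R t); split=> [r|r||||x].
- exact: gr_elt_comm.
- exact: gr_elt_comm.
- by rewrite gr_eltM ss.
- by rewrite !gr_eltM ttt.
- by rewrite !gr_eltM st.
(* The six elements are told apart by their values at 0 and 1. *)
rewrite (gr_enum (e := [:: 1; t; t * t; s; t * s; t * t * s]%g) x); last first.
- by rewrite card_Sn.
- apply: (@map_uniq _ _ (fun g : 'S_3 => (g i0, g i1))) => /=.
  by rewrite !permM !perm1 !(t0, t1, t2, s0, s1, s2).
rewrite !big_cons big_nil addr0 -!gr_eltM gr_elt1 mulr1 !addrA.
exists (gr_coef x 1%g), (gr_coef x t), (gr_coef x (t * t)%g).
exists (gr_coef x s), (gr_coef x (t * s)%g), (gr_coef x (t * t * s)%g).
by rewrite 2!mulrDl !mulrA !addrA.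
Qed.

Theorem theorem4 (R : pzRingType) :
  abelian_ring R -> exchange_ring R ->
  clean_ring (group_ring R 'Z_2) /\ clean_ring (group_ring R 'S_3).
Proof.
move=> abR exR; split; first exact: (quad_clean abR exR (z2_quadratic R)).
by have [s [t gen]] := s3_group_ring R; apply: (s3_clean abR exR gen).
Qed.
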